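(* Let $A,B,C\in\mathbb{C}^{N\times N}$ be pairwise commuting matrices such that $B+sI$ and $C+sI$ are invertible for every integer $s\ge0$. Then ${}_1F_2={}_1F_2(A;B,C;z)$ satisfies $$\left[\theta(\theta I+B-I)(\theta I+C-I)-z(\theta I+A)\right]{}_1F_2=\mathbf{0},$$ where $\theta=z\frac{d}{dz}$.
   Context: $I$ is the $N\times N$ identity matrix and $\mathbf 0$ the zero matrix. For $M\in\mathbb{C}^{N\times N}$, $(M)_0=I$, $(M)_k=M(M+I)\cdots(M+(k-1)I)$ for $k\ge1$, and ${}_1F_2(A;B,C;z)=\sum_{k\ge0}\frac{z^k}{k!}(A)_k[(B)_k]^{-1}[(C)_k]^{-1}$. Matrices act by multiplication and products of operators are compositions. *)

(* Defs.v *)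
From HB Require Import structures.
From mathcomp Require Import all_boot all_order all_algebra.
From mathcomp Require Import all_classical all_reals all_analysis.
From mathcomp Require Import complex.

Set Implicit Arguments.
Unset Strict Implicit.
Unset Printing Implicit Defensive.

Import Order.TTheory GRing.Theory Num.Theory.
Import numFieldNormedType.Exports.

Local Open Scope classical_set_scope.
Local Open Scope complex_scope.
Local Open Scope ring_scope.

(* R[i] packed as a field structure: the topology, norm and normed-module
   instances of MathComp-Analysis are keyed on the sort of such a structure
   and are not found on the bare type R[i]. *)
Definition Cplx (R : realType) : numClosedFieldType := R[i].

Section Hypergeometric.
Variables (R : realType) (N : nat).
Local Notation C := (Cplx R).
Local Notation MC := 'M[C]_N.

(* The factors are multiplied in the order M (M + I) ... (M + (k-1) I). *)
Definition mpoch (M : MC) (k : nat) : MC :=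
  \big[mulmx/1%:M]_(0 <= j < k) (M + j%:R%:M).

Definition hyp1F2_term (A B D : MC) (z : C) (k : nat) : MC :=
  (z ^+ k / k`!%:R) *:
    (mpoch A k *m invmx (mpoch B k) *m invmx (mpoch D k)).

(* The limit is taken in the entrywise topology of matrices. *)
Definition hyp1F2 (A B D : MC) (z : C) : MC :=
  limn (series (hyp1F2_term A B D z)).

(* z d/dz; derive1 is the complex derivative, the scalar field being C. *)
Definition theta (F : C -> MC) : C -> MC := fun z => z *: derive1 F z.

(* The operator theta I + M, where M acts by left multiplication. *)
Definition theta_add (M : MC) (F : C -> MC) : C -> MC :=
  fun z => theta F z + M *m F z.

Definition hyp1F2_op (A B D : MC) (F : C -> MC) : C -> MC :=
  fun z => theta (theta_add (B - 1%:M) (theta_add (D - 1%:M) F)) z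
           - z *: theta_add A F z.

End Hypergeometric.

(* Main.v *)
Require Import Defs.
From HB Require Import structures.
From mathcomp Require Import all_boot all_order all_algebra.
From mathcomp Require Import all_classical all_reals all_analysis.
From mathcomp Require Import complex.
From mathcomp Require Import ring zify.

Set Implicit Arguments.
Unset Strict Implicit.
Unset Printing Implicit Defensive.

Import Order.TTheory GRing.Theory Num.Theory.
Import numFieldNormedType.Exports.

Local Open Scope classical_set_scope.
Local Open Scope ring_scope.

(** Write the hypergeometric function as the power series of z with matrix
coefficients c_k = (A)_k ((B)_k)^-1 ((C)_k)^-1 / k!.  On such a series the
operator theta + M acts coefficientwise, multiplying c_k on the left by M + k.
Hence theta (theta + B - 1) (theta + C - 1) turns c_k into
k (B + k - 1) (C + k - 1) c_k, while z (theta + A) puts (A + k) c_k in degree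
k + 1.  The differential equation is thus the vanishing of the constant term
together with the recurrence
  (k + 1) (B + k) (C + k) c_(k+1) = (A + k) c_k,
which is [hyp1F2_coef_rec].  Commutation is used there: it lets
the factors B + k and C + k travel through the product to the inverse
Pochhammer symbols, where each of them cancels.

The analytic content is that all series met on the way may be differentiated
term by term.  Call c entire when |c_k| r^k is bounded in k for every r >= 0.
Being entire is stable under multiplication of c_k by k and by a fixed matrix,
so it passes from the coefficients of F to those of (theta + M) F.  It makes
the series converge everywhere, because |c_k| r^k is then even dominated by a
geometric progression, and it makes the sum differentiable, because of the
elementary estimate [norm_expr_taylor1_le]: for |h| <= 1,
  |(h + z)^k - z^k - k h z^(k-1)| <= |h|^2 (|z| + 1)^k.
Summing it against c_k bounds the first order Taylor remainder of the series by
a constant times |h|^2 ([psum_taylor1]).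

That the hypergeometric coefficients are entire also follows from the
recurrence ([entire_of_recurrence]).  For large k the matrices B + k and C + k
expand norms by a factor of order k and A + k by at most a factor of order k,
so |c_(k+1)| is at most a constant times |c_k| / k^2. *)

(** * Series of complex numbers dominated by a geometric progression *)

Section ComplexSeries.
Variable R : realType.
Local Notation C := (Cplx R).

(** The order of the complex numbers is partial and norms are complex numbers;
this is the bridge to estimates over the reals. *)
Lemma Cplx_ge0_real (x : C) : 0 <= x -> exists2 a : R, 0 <= a & x = a%:C%C.
Proof.
case: x => a b; rewrite (@lecE R) /= => /andP[/eqP -> a0].
by exists a.
Qed.

Lemma Cplx_archi (x : C) : exists n : nat, `|x| <= n%:R.
Proof.
have [a a0 ->] := Cplx_ge0_real (normr_ge0 x).
have [n an] : exists n : nat, a <= n%:R.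
  by exists (Num.truncn a).+1; rewrite ltW// truncnS_gt.
exists n; rewrite (_ : n%:R = (n%:R : R)%:C%C) ?lecR//.
by rewrite [RHS](rmorph_nat (@real_complex R)).
Qed.

Lemma cvg_real_geometric_dominated (a : nat -> R) (b : R) :
  (forall k, `|a k| <= b / 2 ^+ k) -> cvgn (series a).
Proof.
move=> ab; apply: normed_cvg.
apply: (@series_le_cvg R _ (geometric b 2^-1)).
- by move=> k; exact: normr_ge0.
- move=> k /=; rewrite exprVn; exact: le_trans (normr_ge0 _) (ab k).
- by move=> k /=; rewrite exprVn.
- apply: is_cvg_geometric_series.
  by rewrite ger0_norm ?invr_ge0 ?ler0n// invf_lt1 ?ltr0n// ltr1n.
Qed.

Lemma cvg_Cplx_of_Re_Im (u : nat -> C) (x y : R) :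
  (fun n => complex.Re (u n)) @ \oo --> x ->
  (fun n => complex.Im (u n)) @ \oo --> y ->
  u @ \oo --> (x +i* y : C)%C.
Proof.
move=> /cvgrPdist_le ux /cvgrPdist_le uy; apply/cvgrPdist_le => e e0.
have [a a0 ea] := Cplx_ge0_real (ltW e0).
have a2 : 0 < a / 2.
  by rewrite divr_gt0 ?ltr0n//; move: e0; rewrite ea (@ltcR R).
near=> n.
have xn : `|x - complex.Re (u n)| <= a / 2 by near: n; exact: ux.
have yn : `|y - complex.Im (u n)| <= a / 2 by near: n; exact: uy.
rewrite ea (splitr a).
move: (u n) xn yn => [p q] /= xn yn.
set d : C := _ - _.
have -> : d = ((x - p) +i* 0)%C + (0 +i* (y - q))%C.
  by apply/eqP; rewrite /d eq_complex /=; apply/andP; split; apply/eqP; simpc.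
apply: le_trans (ler_normD _ _) _.
rewrite [X in _ <= X](rmorphD (@real_complex R)).
by apply: lerD; rewrite normc_def /= expr0n/= ?addr0 ?add0r sqrtr_sqr (@lecR R).
Unshelve. all: by end_near. Qed.

(** Completeness of the complex numbers, in the only form used below: both the
real and the imaginary part of the series converge absolutely. *)
Lemma cvg_Cplx_geometric_dominated (u : nat -> C) (b : C) :
  (forall k, `|u k| <= b / 2 ^+ k) -> cvgn (series u).
Proof.
move=> ub; have b0 : 0 <= b.
  by apply: le_trans (normr_ge0 (u 0)) _; rewrite -[b]divr1; exact: ub.
have [a _ ba] := Cplx_ge0_real b0.
have normRI k : `|complex.Re (u k)| <= a / 2 ^+ k /\
                `|complex.Im (u k)| <= a / 2 ^+ k.
  have : `|u k| <= (a / 2 ^+ k)%:C%C.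
    rewrite (le_trans (ub k))// ba (rmorphM (@real_complex R)).
    rewrite (fmorphV (@real_complex R)) rmorphXn.
    by rewrite (rmorph_nat (@real_complex R)).
  rewrite normc_def (@lecR R) => uk; split; apply: le_trans uk;
    by rewrite -sqrtr_sqr ler_sqrt ?lerDl ?lerDr ?addr_ge0 ?sqr_ge0.
have /cvg_ex[x ux] : cvgn (series (fun k => complex.Re (u k))).
  by apply: (@cvg_real_geometric_dominated _ a) => k; case: (normRI k).
have /cvg_ex[y uy] : cvgn (series (fun k => complex.Im (u k))).
  by apply: (@cvg_real_geometric_dominated _ a) => k; case: (normRI k).
apply/cvg_ex; exists (x +i* y : C)%C; apply: cvg_Cplx_of_Re_Im.
  rewrite (_ : (fun n => _) = series (fun k => complex.Re (u k)))//.
  apply/funext => n.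
  elim: n => [|n ih]; first by rewrite /series/= !big_nil.
  by rewrite !seriesSr -ih; case: (series u n) (u n) => [? ?] [].
rewrite (_ : (fun n => _) = series (fun k => complex.Im (u k)))//.
apply/funext => n.
elim: n => [|n ih]; first by rewrite /series/= !big_nil.
by rewrite !seriesSr -ih /=; case: (series u n) (u n) => [? ?] [].
Qed.

End ComplexSeries.

(** * The entrywise maximum norm of matrices *)

Section MatrixNorm.
Variable C : numFieldType.

Lemma entry_le_mx_norm m n (M : 'M[C]_(m, n)) i j : `|M i j| <= `|M|.
Proof.
rewrite [leRHS]/Num.Def.normr/= mx_normE -[leLHS]nngE num_le.
exact: (le_bigmax _ _ (i, j)).
Qed.

Lemma mx_norm_le m n (M : 'M[C]_(m, n)) (b : C) :
  0 <= b -> (forall i j, `|M i j| <= b) -> `|M| <= b.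
Proof.
move=> /nonnegP[{}b] Mb; rewrite [leLHS]/Num.Def.normr/= mx_normE num_le.
apply/bigmax_leP; split => [|[i j] _]; first by rewrite -num_le/=.
by rewrite -num_le/=; exact: Mb.
Qed.

(** The maximum norm is submultiplicative only up to the inner dimension. *)
Lemma mx_norm_mulmx m n p (M : 'M[C]_(m, n)) (P : 'M[C]_(n, p)) :
  `|M *m P| <= n%:R * `|M| * `|P|.
Proof.
apply: mx_norm_le => [|i j]; first by rewrite !mulr_ge0.
rewrite mxE; apply: le_trans (ler_norm_sum _ _ _) _.
have -> : n%:R * `|M| * `|P| = \sum_(k < n) `|M| * `|P|.
  by rewrite sumr_const card_ord -mulrA mulr_natl.
apply: ler_sum => k _.
by rewrite normrM ler_pM ?entry_le_mx_norm.
Qed.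

Lemma cvg_mx m n (u : nat -> 'M[C]_(m, n)) (L : 'M[C]_(m, n)) :
  (forall i j, (fun k => u k i j) @ \oo --> L i j) -> u @ \oo --> L.
Proof.
move=> uL; apply/cvgrPdist_le => e e0; near=> k.
apply: mx_norm_le => [|i j]; first exact: ltW.
rewrite !mxE; move: i j.
have : forall ij : 'I_m * 'I_n, `|L ij.1 ij.2 - u k ij.1 ij.2| <= e.
  near: k; apply: filter_forall => ij.
  by have /cvgrPdist_le/(_ _ e0) := uL ij.1 ij.2.
by move=> h i j; exact: (h (i, j)).
Unshelve. all: by end_near. Qed.

Lemma cvg_mulmxr m n p (M : 'M[C]_(m, n))
    (u : nat -> 'M[C]_(n, p)) (L : 'M[C]_(n, p)) :
  u @ \oo --> L -> (fun k => M *m u k) @ \oo --> M *m L.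
Proof.
move=> /cvgrPdist_le uL; apply/cvgrPdist_le => e e0.
have a0 : 0 < n%:R * `|M| + 1 by rewrite ltr_wpDl// mulr_ge0.
near=> k; rewrite -mulmxBr; apply: le_trans (mx_norm_mulmx _ _) _.
have : `|L - u k| <= e / (n%:R * `|M| + 1).
  by near: k; apply: uL; rewrite divr_gt0.
rewrite ler_pdivlMr// mulrC => he; apply: le_trans he.
by rewrite ler_wpM2r// lerDl.
Unshelve. all: by end_near. Qed.

End MatrixNorm.

Lemma cvg_mx_geometric_dominated (R : realType) m n
    (u : nat -> 'M[Cplx R]_(m, n)) (b : Cplx R) :
  (forall k, `|u k| <= b / 2 ^+ k) -> cvgn (series u).
Proof.
move=> ub.
have cvgu i j : cvgn (series (fun k => u k i j)).
  apply: (@cvg_Cplx_geometric_dominated _ _ b) => k.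
  exact: le_trans (entry_le_mx_norm _ _ _) (ub k).
apply/cvg_ex; exists (\matrix_(i, j) limn (series (fun k => u k i j))).
apply: cvg_mx => i j; rewrite mxE.
rewrite (_ : (fun k => _) = series (fun k => u k i j)); first exact: cvgu.
by apply/funext => k; rewrite /series/= summxE.
Qed.

(** * Bounds on limits and on powers *)

(** Balls are closed also over a partially ordered field of scalars, because
norms are real and therefore comparable with each other. *)
Lemma norm_lim_le (K : numFieldType) (V : normedModType K) (u : nat -> V)
    (l : V) (b : K) :
  u @ \oo --> l -> (forall n, `|u n| <= b) -> `|l| <= b.
Proof.
move=> /cvgrPdist_lt ul ub.
have b0 : 0 <= b by exact: le_trans (normr_ge0 _) (ub 0).
case: (real_leP (normr_real l) (ger0_real b0)) => // bl.
have lb0 : 0 < `|l| - b by rewrite subr_gt0.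
have [n _ /(_ n (leqnn n)) /= ln] := ul _ lb0.
have : `|l| < `|l|.
  rewrite -{1}(subrK (u n) l); apply: le_lt_trans (ler_normD _ _) _.
  by rewrite -[ltRHS](subrK b) ltr_leD.
by rewrite ltxx.
Qed.

Lemma norm_series_geometric_le (K : numFieldType) (V : normedModType K)
    (v : nat -> V) (b : K) (n : nat) :
  (forall k, `|v k| <= b / 2 ^+ k) -> `|series v n| <= 2 * b.
Proof.
move=> vb.
have b0 : 0 <= b.
  by apply: le_trans (normr_ge0 (v 0)) _; rewrite -[b]divr1; exact: vb.
(* the exact partial sum of the majorant, which makes the induction work *)
have : `|series v n| <= 2 * b - 2 * b / 2 ^+ n.
  elim: n => [|n ih]; first by rewrite /series/= big_nil normr0 expr0 divr1 subrr.
  rewrite seriesSr; apply: le_trans (ler_normD _ _) _.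
  apply: le_trans (lerD ih (vb n)) _.
  rewrite le_eqVlt; apply/orP; left; apply/eqP; rewrite exprS.
  have : 2 ^+ n != 0 :> K by rewrite expf_neq0// pnatr_eq0.
  by move=> n0; field.
move/le_trans; apply; rewrite gerBl divr_ge0 ?mulr_ge0 ?exprn_ge0 ?ler0n//.
Qed.

Section PowerBounds.
Variables (K : numFieldType).
Implicit Types (z h : K) (k : nat).

(** The factor 2 in the base absorbs k, since k <= 2^k. *)
Lemma norm_deriv_expr_le z k :
  `|k%:R * z ^+ k.-1| <= (2 * (`|z| + 1)) ^+ k.
Proof.
rewrite normrM normr_nat normrX exprMn; apply: ler_pM => //.
- by rewrite -natrX ler_nat ltnW// ltn_expl.
- have zz : `|z| <= `|z| + 1 by rewrite lerDl.
  apply: (@le_trans _ _ ((`|z| + 1) ^+ k.-1)); first by rewrite lerXn2r ?nnegrE ?addr_ge0.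
  by apply: ler_weXn2l (leq_pred k); rewrite lerDr.
Qed.

Lemma norm_expr_diff_le z h k : `|h| <= 1 ->
  `|(h + z) ^+ k - z ^+ k| <= `|h| * (`|z| + 1) ^+ k.
Proof.
move=> h1; have r0 : 0 <= `|z| + 1 by rewrite addr_ge0.
elim: k => [|k ih]; first by rewrite !expr0 subrr normr0 mulr1.
have -> : (h + z) ^+ k.+1 - z ^+ k.+1 =
    z * ((h + z) ^+ k - z ^+ k) + h * (h + z) ^+ k by rewrite !exprS; ring.
have -> : `|h| * (`|z| + 1) ^+ k.+1 =
    `|z| * (`|h| * (`|z| + 1) ^+ k) + `|h| * (`|z| + 1) ^+ k.
  by rewrite exprS; ring.
apply: le_trans (ler_normD _ _) _; rewrite !normrM; apply: lerD.
  by apply: ler_pM.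
apply: ler_pM => //; rewrite normrX lerXn2r ?nnegrE//.
by apply: le_trans (ler_normD _ _) _; rewrite addrC lerD.
Qed.

(** By induction on k: the remainder at k + 1 is z times the remainder at k plus
h times the difference bounded in [norm_expr_diff_le]. *)
Lemma norm_expr_taylor1_le z h k : `|h| <= 1 ->
  `|(h + z) ^+ k - z ^+ k - h * (k%:R * z ^+ k.-1)|
    <= `|h| ^+ 2 * (`|z| + 1) ^+ k.
Proof.
move=> h1; have r0 : 0 <= `|z| + 1 by rewrite addr_ge0.
elim: k => [|k ih].
  by rewrite !expr0 mul0r mulr0 !subrr normr0 mulr1 exprn_ge0.
have -> : (h + z) ^+ k.+1 - z ^+ k.+1 - h * (k.+1%:R * z ^+ k.+1.-1) =
    z * ((h + z) ^+ k - z ^+ k - h * (k%:R * z ^+ k.-1)) +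
    h * ((h + z) ^+ k - z ^+ k).
  case: k {ih} => [|k] /=; first ring.
  rewrite (exprS (h + z)) -[k.+2%:R]natr1 !(exprS z).
  move: ((h + z) ^+ k.+1) (z ^+ k) k.+1%:R => p q a; ring.
have -> : `|h| ^+ 2 * (`|z| + 1) ^+ k.+1 =
    `|z| * (`|h| ^+ 2 * (`|z| + 1) ^+ k) + `|h| * (`|h| * (`|z| + 1) ^+ k).
  by rewrite (exprS (`|z| + 1)); ring.
apply: le_trans (ler_normD _ _) _; rewrite !normrM; apply: lerD.
  by apply: ler_pM.
by apply: ler_pM => //; exact: norm_expr_diff_le.
Qed.

End PowerBounds.

(** * Everywhere convergent power series with matrix coefficients *)

Section EntireSeries.
Variables (R : realType) (m n : nat).
Local Notation C := (Cplx R).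
Local Notation M := 'M[C]_(m, n).
Implicit Types (c : nat -> M) (z r : C).

(** By the Cauchy-Hadamard formula, this says that the power series with
coefficients c has infinite radius of convergence. *)
Definition entire c :=
  forall r, 0 <= r -> exists b : C, forall k, `|c k| * r ^+ k <= b.

Definition psum c z : M := limn (series (fun k => z ^+ k *: c k)).

Lemma entireD c1 c2 :
  entire c1 -> entire c2 -> entire (fun k => c1 k + c2 k).
Proof.
move=> e1 e2 r r0; have [b1 h1] := e1 r r0; have [b2 h2] := e2 r r0.
exists (b1 + b2) => k; apply: le_trans (lerD (h1 k) (h2 k)).
by rewrite -mulrDl ler_wpM2r ?exprn_ge0// ler_normD.
Qed.

Lemma entireMn c : entire c -> entire (fun k => k%:R *: c k).
Proof.
move=> ec r r0; have [b cb] := ec (2 * r) (mulr_ge0 (ler0n _ 2) r0).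
exists b => k; apply: le_trans (cb k).
rewrite normrZ normr_nat exprMn [leRHS]mulrCA -[leLHS]mulrA.
by rewrite ler_wpM2r ?mulr_ge0 ?exprn_ge0// -natrX ler_nat ltnW// ltn_expl.
Qed.

(** The bound for the radius 2 r, read at the radius r. *)
Lemma entire_geometric c r : entire c -> 0 <= r ->
  exists b : C, forall k, `|c k| * r ^+ k <= b / 2 ^+ k.
Proof.
move=> ec r0; have [b cb] := ec (2 * r) (mulr_ge0 (ler0n _ 2) r0).
exists b => k; rewrite ler_pdivlMr ?exprn_gt0 ?ltr0n//.
by rewrite -mulrA -exprMn [r * 2]mulrC.
Qed.

(** Common source of the convergence of a power series, with a k = z^k, and of
its termwise derivative, with a k = k z^(k-1). *)
Lemma cvg_entire_weighted c (r : C) (a : nat -> C) :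
  entire c -> 0 <= r -> (forall k, `|a k| <= r ^+ k) ->
  cvgn (series (fun k => a k *: c k)).
Proof.
move=> ec r0 ar; have [b cb] := entire_geometric ec r0.
apply: (@cvg_mx_geometric_dominated _ _ _ _ b) => k; apply: le_trans (cb k).
by rewrite normrZ mulrC ler_wpM2l.
Qed.

Lemma cvg_psum c z : entire c ->
  series (fun k => z ^+ k *: c k) @ \oo --> psum c z.
Proof.
move=> ec; apply: (cvg_entire_weighted ec (normr_ge0 z)) => k.
by rewrite normrX.
Qed.

Lemma psum_eq c z (l : M) :
  series (fun k => z ^+ k *: c k) @ \oo --> l -> psum c z = l.
Proof. by move=> h; apply/cvg_lim => //; exact: norm_hausdorff. Qed.

(** The index is not shifted: the term of index 0 vanishes through its factor
0%:R, and every sum over c stays indexed like c itself. *)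
Definition dpsum c z : M := limn (series (fun k => (k%:R * z ^+ k.-1) *: c k)).

Lemma cvg_dpsum c z : entire c ->
  series (fun k => (k%:R * z ^+ k.-1) *: c k) @ \oo --> dpsum c z.
Proof.
move=> ec; apply: (cvg_entire_weighted (r := 2 * (`|z| + 1)) ec).
  by rewrite mulr_ge0 ?addr_ge0.
by move=> k; exact: norm_deriv_expr_le.
Qed.

(** The three sums are limits of partial sums whose combination is bounded term
by term by [norm_expr_taylor1_le]. *)
Lemma psum_taylor1 c z : entire c ->
  exists b : C, forall h, `|h| <= 1 ->
  `|psum c (h + z) - psum c z - h *: dpsum c z| <= `|h| ^+ 2 * b.
Proof.
move=> ec; have r0 : 0 <= `|z| + 1 by rewrite addr_ge0.
have [b cb] := entire_geometric ec r0.
exists (2 * b) => h h1; rewrite mulrCA.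
pose v k : M := ((h + z) ^+ k - z ^+ k - h * (k%:R * z ^+ k.-1)) *: c k.
apply: (@norm_lim_le _ _ (series v)); last first.
  move=> k; apply: norm_series_geometric_le => {}k.
  rewrite /v normrZ -mulrA.
  apply: (@le_trans _ _ ((`|h| ^+ 2 * (`|z| + 1) ^+ k) * `|c k|)).
    by apply: ler_wpM2r => //; exact: norm_expr_taylor1_le.
  by rewrite -mulrA ler_wpM2l ?exprn_ge0// mulrC.
rewrite (_ : series v = fun j => series (fun k => (h + z) ^+ k *: c k) j
    - series (fun k => z ^+ k *: c k) j
    - h *: series (fun k => (k%:R * z ^+ k.-1) *: c k) j); last first.
  apply/funext => j; rewrite /series/= scaler_sumr -!sumrB.
  by apply: eq_bigr => k _; rewrite /v !scalerBl scalerA.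
apply: cvgB; first by apply: cvgB; exact: cvg_psum.
by apply: cvgZl_tmp; exact: cvg_dpsum.
Qed.

Lemma cvg_psum_diff c z : entire c ->
  h^-1 *: (psum c (h + z) - psum c z) @[h --> 0^'] --> dpsum c z.
Proof.
move=> ec; have [b hb] := psum_taylor1 z ec.
(* b + 1 rather than b below, as b may vanish *)
have b0 : 0 <= b.
  have := hb 1; rewrite normr1 lexx expr1n mul1r => /(_ isT).
  exact: le_trans.
apply/cvgrPdist_le => e e0; near=> h.
have h0 : h != 0 by near: h; exact: nbhs_dnbhs_neq.
rewrite distrC -[X in _ - X](scalerK h0) -scalerBr normrZ normfV.
rewrite ler_pdivrMl ?normr_gt0//.
apply: le_trans (hb h _) _; first by near: h; exact: dnbhs0_le.
rewrite expr2 -mulrA ler_wpM2l//.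
have : `|h| <= e / (b + 1).
  by near: h; apply: dnbhs0_le; rewrite divr_gt0// ltr_wpDl.
rewrite ler_pdivlMr ?ltr_wpDl// => he.
by apply: le_trans he; rewrite ler_wpM2l// lerDl.
Unshelve. all: by end_near. Qed.

Lemma derivable_psum c z : entire c -> derivable (psum c) z 1.
Proof.
move=> ec; apply/cvg_ex; exists (dpsum c z).
rewrite (_ : (fun h => _) =
  (fun h : C => h^-1 *: (psum c (h + z) - psum c z))); first exact: cvg_psum_diff.
by apply/funext => h /=; rewrite [h *: 1]mulr1.
Qed.

(** The factor z brings k z^(k-1) back to the k z^k of a power series. *)
Lemma scale_derive1_psum c z : entire c ->
  z *: derive1 (psum c) z = psum (fun k => k%:R *: c k) z.
Proof.
move=> ec.
have -> : derive1 (psum c) z = dpsum c z.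
  by apply/cvg_lim; [exact: norm_hausdorff|exact: cvg_psum_diff].
symmetry; apply: psum_eq.
rewrite (_ : series _ =
    fun j => z *: series (fun k => (k%:R * z ^+ k.-1) *: c k) j).
  by apply: cvgZl_tmp; exact: cvg_dpsum.
apply/funext => j; rewrite /series/= scaler_sumr; apply: eq_bigr => k _.
by rewrite !scalerA; case: k => [|k]; rewrite ?mul0r ?mulr0// mulrCA -exprS mulrC.
Qed.

End EntireSeries.

(** * The operators theta + M on power series *)

Section Theta.
Variables (R : realType) (N : nat).
Local Notation C := (Cplx R).
Local Notation MC := 'M[C]_N.
Implicit Types (c : nat -> MC) (z : C).

Lemma entireMmx (M : MC) c : entire c -> entire (fun k => M *m c k).
Proof.
move=> ec r r0; have [b cb] := ec r r0.
exists (N%:R * `|M| * b) => k.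
have rk : 0 <= r ^+ k by rewrite exprn_ge0.
apply: le_trans (ler_wpM2r rk (mx_norm_mulmx M (c k))) _.
by rewrite -!mulrA !ler_wpM2l.
Qed.

Definition theta_add_coef (M : MC) c : nat -> MC :=
  fun k => (M + k%:R%:M) *m c k.

Lemma theta_add_coefE M c k :
  theta_add_coef M c k = k%:R *: c k + M *m c k.
Proof. by rewrite /theta_add_coef mulmxDl mul_scalar_mx addrC. Qed.

Lemma entire_theta_add_coef M c : entire c -> entire (theta_add_coef M c).
Proof.
move=> ec r r0.
have [b hb] := entireD (entireMn ec) (entireMmx M ec) r0.
by exists b => k; rewrite theta_add_coefE.
Qed.

Lemma theta_add_psum M c : entire c ->
  theta_add M (psum c) = psum (theta_add_coef M c).
Proof.
move=> ec; apply/funext => z; rewrite /theta_add /theta.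
rewrite scale_derive1_psum//.
symmetry; apply: psum_eq.
rewrite (_ : series _ = fun j => series (fun k => z ^+ k *: (k%:R *: c k)) j
    + M *m series (fun k => z ^+ k *: c k) j).
  apply: cvgD; first exact/cvg_psum/entireMn.
  by apply: cvg_mulmxr; exact: cvg_psum.
apply/funext => j; rewrite /series/= mulmx_sumr -big_split/=.
by apply: eq_bigr => k _; rewrite theta_add_coefE scalerDr -scalemxAr.
Qed.

Lemma scale_psum c d z : entire c -> entire d ->
  d 0 = 0 -> (forall k, d k.+1 = c k) -> psum d z = z *: psum c z.
Proof.
move=> ec ed d0 dS; apply: psum_eq; rewrite -cvg_shiftS/=.
rewrite (_ : (fun n => _) = fun j => z *: series (fun k => z ^+ k *: c k) j).
  by apply: cvgZl_tmp; exact: cvg_psum.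
apply/funext => j; rewrite /series/= big_nat_recl// d0 scaler0 add0r.
rewrite scaler_sumr; apply: eq_bigr => k _.
by rewrite dS exprS scalerA.
Qed.

(** From some index n0 on, |c_k| r^k decreases, so it is bounded by the sum of
its values up to n0. *)
Lemma entire_of_ratio c :
  (forall r, 0 <= r -> exists n0, forall k, (n0 <= k)%N ->
     r * `|c k.+1| <= `|c k|) -> entire c.
Proof.
move=> hc r r0; have [n0 hn0] := hc r r0.
exists (\sum_(j < n0.+1) `|c j| * r ^+ j) => k.
have nn j : 0 <= `|c j| * r ^+ j by rewrite mulr_ge0 ?exprn_ge0.
have small j : (j <= n0)%N ->
    `|c j| * r ^+ j <= \sum_(j < n0.+1) `|c j| * r ^+ j.
  move=> jn; have jn' : (j < n0.+1)%N by [].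
  rewrite (bigD1 (Ordinal jn'))//= lerDl sumr_ge0// => i _; exact: nn.
elim: k => [|k ih]; first exact: small.
case: (leqP k.+1 n0) => kn; first exact: small.
apply: le_trans ih; rewrite exprS mulrA [_ * r]mulrC.
by rewrite ler_wpM2r ?exprn_ge0// hn0.
Qed.

(** A lower bound on the left multiplication by M + k replaces an upper bound on
the norm of the inverse of M + k. *)
Lemma norm_shift_mulmx_ge (M X : MC) (k : nat) :
  (k%:R - N%:R * `|M|) * `|X| <= `|(M + k%:R%:M) *m X|.
Proof.
rewrite mulrBl lerBlDr mulmxDl mul_scalar_mx.
have -> : k%:R * `|X| = `|(M *m X + k%:R *: X) - M *m X|.
  by rewrite addrAC subrr add0r normrZ normr_nat.
by apply: le_trans (ler_normB _ _) _; rewrite lerD2l mx_norm_mulmx.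
Qed.

Lemma norm_shift_mulmx_le (M X : MC) (k : nat) :
  `|(M + k%:R%:M) *m X| <= (k%:R + N%:R * `|M|) * `|X|.
Proof.
rewrite mulmxDl mul_scalar_mx mulrDl addrC.
apply: le_trans (ler_normD _ _) _.
by rewrite normrZ normr_nat lerD2l mx_norm_mulmx.
Qed.

(** Comparing norms on both sides, with |M| standing for N times the norm of M:
  (k + 1) (k - |B|) (k - |D|) |c_(k+1)| <= (k + |A|) |c_k|.
For large k the three factors k - |B|, k - |D| and k + |A| are respectively at
least 1, at least 2 r and at most 2 (k + 1), which leaves
r |c_(k+1)| <= |c_k|. *)
Lemma entire_of_recurrence (A B D : MC) c :
  (forall k, k.+1%:R *: ((B + k%:R%:M) *m ((D + k%:R%:M) *m c k.+1))
             = (A + k%:R%:M) *m c k) -> entire c.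
Proof.
move=> rec; apply: entire_of_ratio => r r0.
have [a ha] := Cplx_archi (N%:R * `|A|).
have [b hb] := Cplx_archi (N%:R * `|B|).
have [d hd] := Cplx_archi (N%:R * `|D|).
have [e he] := Cplx_archi r.
exists (a + b.+1 + d + 2 * e)%N => k kn.
have nn (M : MC) : `|N%:R * `|M| : C| = N%:R * `|M|.
  by rewrite ger0_norm// mulr_ge0.
rewrite !nn (ger0_norm r0) in ha hb hd he.
have kb : 1 <= k%:R - N%:R * `|B|.
  rewrite lerBrDr; apply: (@le_trans _ _ (b.+1%:R)); last first.
    by rewrite ler_nat; lia.
  by rewrite -natr1 addrC lerD2r.
have kd : 2 * r <= k%:R - N%:R * `|D|.
  rewrite lerBrDr; apply: (@le_trans _ _ ((2 * e + d)%:R)); last first.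
    by rewrite ler_nat; lia.
  by rewrite natrD natrM lerD// ler_wpM2l.
have ka : k%:R + N%:R * `|A| <= 2 * k.+1%:R.
  rewrite mulr2n mulrDl mul1r lerD//; first by rewrite ler_nat.
  apply: le_trans ha _; by rewrite ler_nat; lia.
have step : k.+1%:R * (2 * r * `|c k.+1|) <= k.+1%:R * (2 * `|c k|).
  apply: (@le_trans _ _ `|(A + k%:R%:M) *m c k|).
    rewrite -rec normrZ normr_nat ler_wpM2l//.
    apply: le_trans (norm_shift_mulmx_ge _ _ _).
    apply: (@le_trans _ _ (1 * `|(D + k%:R%:M) *m c k.+1|)); last first.
      by rewrite ler_wpM2r.
    rewrite mul1r; apply: le_trans (norm_shift_mulmx_ge _ _ _).
    by rewrite ler_wpM2r.
  apply: le_trans (norm_shift_mulmx_le _ _ _) _.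
  by rewrite mulrCA mulrA ler_wpM2r.
by move: step; rewrite ler_pM2l ?ltr0n// -mulrA ler_pM2l ?ltr0n//.
Qed.

(** In degree k + 1 the two sides of the equation are the two sides of the
recurrence, and in degree 0 the outer theta leaves nothing. *)
Lemma hyp1F2_op_psum (A B D : MC) c z : entire c ->
  (forall k, k.+1%:R *: ((B + k%:R%:M) *m ((D + k%:R%:M) *m c k.+1))
             = (A + k%:R%:M) *m c k) ->
  hyp1F2_op A B D (psum c) z = 0.
Proof.
move=> ec rec; have ec1 := entire_theta_add_coef (D - 1%:M) ec.
have ec2 := entire_theta_add_coef (B - 1%:M) ec1.
rewrite /hyp1F2_op (theta_add_psum _ ec) (theta_add_psum _ ec1).
rewrite (theta_add_psum _ ec) [theta _ _]scale_derive1_psum//.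
apply/eqP; rewrite subr_eq0; apply/eqP; apply: scale_psum.
- exact: entire_theta_add_coef.
- exact: entireMn.
- by rewrite scale0r.
- move=> k; rewrite /theta_add_coef -rec.
  have shift (M : MC) : M - 1%:M + k.+1%:R%:M = M + k%:R%:M.
    by rewrite -natr1 raddfD /= [k%:R%:M + _]addrC addrA subrK.
  by rewrite !shift.
Qed.

End Theta.

(** * The hypergeometric coefficients *)

HB.instance Definition _ (S : pzSemiRingType) (n : nat) :=
  Monoid.isLaw.Build 'M[S]_n 1%:M mulmx
    (@mulmxA S n n n n) (@mul1mx S n n) (@mulmx1 S n n).

Lemma mulmx_push_comm (S : pzSemiRingType) (n : nat) (B D P U V : 'M[S]_n) :
  comm_mx B P -> comm_mx D P -> comm_mx D U ->
  B *m (D *m (P *m U *m V)) = P *m (B *m U) *m (D *m V).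
Proof.
move=> BP DP DU; rewrite !mulmxA.
by rewrite -(mulmxA B) DP -!mulmxA (mulmxA D) DU !mulmxA BP.
Qed.

Section Pochhammer.
Variables (R : realType) (N : nat).
Local Notation C := (Cplx R).
Local Notation MC := 'M[C]_N.
Implicit Types (A B D X Y : MC).

Lemma mpochS X k : mpoch X k.+1 = mpoch X k *m (X + k%:R%:M).
Proof. by rewrite /mpoch big_nat_recr. Qed.

Lemma comm_mx_shift X Y (a b : C) :
  comm_mx X Y -> comm_mx (X + a%:M) (Y + b%:M).
Proof.
move=> XY; apply: comm_mxD; last exact: comm_mx_scalar.
by apply: comm_mx_sym; apply: comm_mxD;
  [exact: comm_mx_sym|exact: comm_mx_scalar].
Qed.

Lemma comm_mx_mpoch X Y (a : C) k :
  comm_mx X Y -> comm_mx (X + a%:M) (mpoch Y k).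
Proof.
move=> XY; elim: k => [|k ih]; first by rewrite /mpoch big_nil; exact: comm_mx1.
by rewrite mpochS; apply: comm_mxM => //; exact: comm_mx_shift.
Qed.

Lemma comm_mx_inv X Y : Y \in unitmx -> comm_mx X Y -> comm_mx X (invmx Y).
Proof.
move=> uY XY; rewrite /comm_mx.
by rewrite -[X in _ = _ *m X](mulmxK uY) XY mulmxA mulmxA mulVmx// mul1mx.
Qed.

Lemma unitmx_mpoch X k : (forall s : nat, X + s%:R%:M \in unitmx) ->
  mpoch X k \in unitmx.
Proof.
move=> uX; elim: k => [|k ih]; first by rewrite /mpoch big_nil unitmx1.
by rewrite mpochS unitmx_mul ih uX.
Qed.

(** Multiply by (X)_k on the left: both sides become the identity, as
(X)_(k+1) = (X)_k (X + k). *)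
Lemma mul_invmx_mpochS X k : (forall s : nat, X + s%:R%:M \in unitmx) ->
  (X + k%:R%:M) *m invmx (mpoch X k.+1) = invmx (mpoch X k).
Proof.
move=> uX; have uk := unitmx_mpoch k uX; have uk1 := unitmx_mpoch k.+1 uX.
have cancel : mpoch X k *m ((X + k%:R%:M) *m invmx (mpoch X k.+1)) = 1%:M.
  by rewrite mulmxA -mpochS mulmxV.
by rewrite -[LHS](mulKmx uk) cancel mulmx1.
Qed.

Definition hyp1F2_coef A B D k : MC :=
  (k`!%:R : C)^-1 *: (mpoch A k *m invmx (mpoch B k) *m invmx (mpoch D k)).

Lemma hyp1F2_termE A B D (z : C) :
  hyp1F2_term A B D z = fun k => z ^+ k *: hyp1F2_coef A B D k.
Proof. by apply/funext => k; rewrite /hyp1F2_coef scalerA. Qed.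

Lemma hyp1F2_psum A B D : hyp1F2 A B D = psum (hyp1F2_coef A B D).
Proof.
by apply/funext => z; rewrite /hyp1F2 hyp1F2_termE.
Qed.

Lemma hyp1F2_coef_rec A B D k :
  comm_mx A B -> comm_mx A D -> comm_mx B D ->
  (forall s : nat, B + s%:R%:M \in unitmx) ->
  (forall s : nat, D + s%:R%:M \in unitmx) ->
  k.+1%:R *: ((B + k%:R%:M) *m ((D + k%:R%:M) *m hyp1F2_coef A B D k.+1)) =
  (A + k%:R%:M) *m hyp1F2_coef A B D k.
Proof.
move=> AB AD BD uB uD; rewrite /hyp1F2_coef -!scalemxAr scalerA.
have -> : k.+1%:R * (k.+1`!%:R)^-1 = (k`!%:R : C)^-1.
  by rewrite factS natrM invfM mulrA mulfV ?mul1r// pnatr_eq0.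
congr (_ *: _).
have BA : comm_mx B A by exact: comm_mx_sym.
have DA : comm_mx D A by exact: comm_mx_sym.
have DB : comm_mx D B by exact: comm_mx_sym.
rewrite (@mulmx_push_comm _ _ (B + k%:R%:M) (D + k%:R%:M) (mpoch A k.+1)
  (invmx (mpoch B k.+1)) (invmx (mpoch D k.+1))).
- rewrite !mul_invmx_mpochS// mpochS -!mulmxA.
  have /= := comm_mx_mpoch k%:R k (comm_mx_refl A).
  by rewrite /comm_mx !mulmxA => ->.
- exact: comm_mx_mpoch.
- exact: comm_mx_mpoch.
- by apply: comm_mx_inv; [exact: unitmx_mpoch|exact: comm_mx_mpoch].
Qed.

End Pochhammer.

Theorem theorem2p10 (R : realType) (N : nat) (A B C : 'M[Cplx R]_N)
    (comAB : comm_mx A B) (comAC : comm_mx A C) (comBC : comm_mx B C)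
    (unitB : forall s : nat, B + s%:R%:M \in unitmx)
    (unitC : forall s : nat, C + s%:R%:M \in unitmx) :
  let F := hyp1F2 A B C in
  let F1 := theta_add (C - 1%:M) F in
  let F2 := theta_add (B - 1%:M) F1 in
  [/\ forall z : Cplx R, cvgn (series (hyp1F2_term A B C z)),
      forall z : Cplx R,
        [/\ derivable F z 1, derivable F1 z 1 & derivable F2 z 1]
    & forall z : Cplx R, hyp1F2_op A B C F z = 0].
Proof.
move=> F F1 F2.
have rec k := hyp1F2_coef_rec k comAB comAC comBC unitB unitC.
have := hyp1F2_psum A B C; rewrite -/F => FE.
have termE z : hyp1F2_term A B C z = fun k => z ^+ k *: hyp1F2_coef A B C k.
  exact: hyp1F2_termE.
rewrite /F2 /F1 FE {F F1 F2 FE}.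
(* from here on only the recurrence for the coefficients matters *)
move: (hyp1F2_coef A B C) rec termE => c rec termE.
have ec : entire c := entire_of_recurrence rec.
have ec1 := entire_theta_add_coef (C - 1%:M) ec.
have ec2 := entire_theta_add_coef (B - 1%:M) ec1.
split=> z.
- by rewrite termE; apply/cvg_ex; exists (psum c z); exact: cvg_psum.
- rewrite (theta_add_psum _ ec) (theta_add_psum _ ec1).
  by split; exact: derivable_psum.
- exact: hyp1F2_op_psum.
Qed.
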